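(* Let $R$ be a commutative ring with identity and let $M$ be a strong comultiplication $R$-module. Then every non-zero proper submodule of $R$ (i.e. every non-zero proper ideal of $R$) is a strongly sum 2-irreducible $R$-module if and only if every non-zero proper submodule of $M$ is a strongly 2-irreducible submodule of $M$.
   Context: An $R$-module $M$ is a comultiplication module if for every submodule $N$ of $M$ there is an ideal $I$ of $R$ with $N=(0:_MI)=\{m\in M: Im=0\}$; equivalently $N=(0:_M\mathrm{Ann}_R(N))$ for every submodule $N$. $M$ satisfies the double annihilator conditions (DAC) if $I=\mathrm{Ann}_R((0:_MI))$ for each ideal $I$ of $R$. $M$ is a strong comultiplication module if it is a comultiplication module and satisfies DAC. A submodule $N$ of an $R$-module $M$ is a strongly sum 2-irreducible submodule if whenever $N\subseteq H_1+H_2+H_3$ for submodules $H_1,H_2,H_3$ of $M$, then $N\subseteq H_1+H_2$ or $N\subseteq H_2+H_3$ or $N\subseteq H_1+H_3$. An $R$-module is a strongly sum 2-irreducible module if it is a strongly sum 2-irreducible submodule of itself. A proper submodule $N$ of $M$ is strongly 2-irreducible if whenever $H_1\cap H_2\cap H_3\subseteq N$ for submodules $H_1,H_2,H_3$ of $M$, then $H_1\cap H_2\subseteq N$ or $H_2\cap H_3\subseteq N$ or $H_1\cap H_3\subseteq N$. *)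

(* Defs.v *)
From HB Require Import structures.
From mathcomp Require Import all_boot all_algebra.
From mathcomp Require Import boolp classical_sets.

Set Implicit Arguments.
Unset Strict Implicit.
Unset Printing Implicit Defensive.

Import GRing.Theory.

Local Open Scope classical_set_scope.
Local Open Scope ring_scope.

(* Submodules of V are the library's [submodClosed V]: bundled boolean          *)
(* predicates containing 0 and stable under linear combinations.  Under the     *)
(* classical axioms of [boolp] every subset of V is the carrier of a boolean    *)
(* predicate, so no submodule is left out.  Ideals of R are the submodules of   *)
(* the regular module R^o.                                                      *)

Section Submodules.
Variables (R : comPzRingType) (V : lmodType R).

Definition nonzero_submod (N : submodClosed V) : Prop :=
  [set` N] <> [set (0 : V)].

Definition proper_submod (N : submodClosed V) : Prop :=
  [set` N] <> [set: V].

Definition full_submod : {pred V} := predT.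

Fact full_submod_closed : subsemimod_closed full_submod.
Proof. by split; split. Qed.

HB.instance Definition _ :=
  GRing.isSubmodClosed.Build R V full_submod full_submod_closed.

(* The submodule N regarded as an R-module in its own right. *)
Definition submod_type (N : submodClosed V) : Type := {x : V | x \in N}.

HB.instance Definition _ (N : submodClosed V) :=
  SubChoice.on (submod_type N).
HB.instance Definition _ (N : submodClosed V) :=
  [SubChoice_isSubLmodule of submod_type N by <:].

Definition sumset (A B : set V) : set V := [set x + y | x in A & y in B].

Definition strongly_sum2_irreducible_submod (N : submodClosed V) : Prop :=
  forall H1 H2 H3 : submodClosed V,
    [set` N] `<=` sumset (sumset [set` H1] [set` H2]) [set` H3] ->
    [\/ [set` N] `<=` sumset [set` H1] [set` H2],
        [set` N] `<=` sumset [set` H2] [set` H3]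
      | [set` N] `<=` sumset [set` H1] [set` H3]].

Definition strongly_2_irreducible_submod (N : submodClosed V) : Prop :=
  proper_submod N /\
  forall H1 H2 H3 : submodClosed V,
    [set` H1] `&` [set` H2] `&` [set` H3] `<=` [set` N] ->
    [\/ [set` H1] `&` [set` H2] `<=` [set` N],
        [set` H2] `&` [set` H3] `<=` [set` N]
      | [set` H1] `&` [set` H3] `<=` [set` N]].

(* (0 :_V I) *)
Definition ann_in_module (I : set R) : set V :=
  [set m | forall a, I a -> a *: m = 0].

(* Ann_R(N) *)
Definition ann_in_ring (N : set V) : set R :=
  [set a | forall m, N m -> a *: m = 0].

End Submodules.

Arguments ann_in_module {R} V I.

Definition strongly_sum2_irreducible_module (R : comPzRingType)
    (V : lmodType R) : Prop :=
  strongly_sum2_irreducible_submod (@full_submod R V).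

Definition comultiplication_module (R : comPzRingType) (M : lmodType R) : Prop :=
  forall N : submodClosed M, exists I : submodClosed R^o,
    [set` N] = ann_in_module M [set` I].

Definition double_annihilator_conditions (R : comPzRingType)
    (M : lmodType R) : Prop :=
  forall I : submodClosed R^o,
    [set` I] = ann_in_ring (ann_in_module M [set` I]).

Definition strong_comultiplication_module (R : comPzRingType)
    (M : lmodType R) : Prop :=
  comultiplication_module M /\ double_annihilator_conditions M.

(* Main.v *)
Require Import Defs.
From HB Require Import structures.
From mathcomp Require Import all_boot all_algebra.
From mathcomp Require Import boolp classical_sets.

(**
  The annihilator I |-> (0 :_M I) is an inclusion-reversing bijection from the
  ideals of R onto the submodules of M that turns sums into intersections, so
  (0 :_M I) is strongly 2-irreducible in M exactly when it is proper and I is a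
  strongly sum 2-irreducible submodule of R.
  It remains to pass between I as a submodule of R and I as a module of its own.
  Suppose that all non-zero proper ideals are strongly sum 2-irreducible modules,
  and let I lie in K = I1 + I2 + I3.  If K is proper, K itself is a sum of two of
  the Ii.  If K = R, then I = I K is the sum of the ideals I \cap Ii, and the
  module I is covered by two of these.
*)

Set Implicit Arguments.
Unset Strict Implicit.
Unset Printing Implicit Defensive.

Import GRing.Theory.
Local Open Scope classical_set_scope.
Local Open Scope ring_scope.

(** * Submodules handled through their carriers: sums, annihilators, images *)

Section SubmoduleSets.
Variables (R : comPzRingType) (V : lmodType R).
Implicit Types (A B : set V) (N H : submodClosed V).

(** Only the carrier is specified, so that sums, annihilators, images and preimages can be traded
    for bundled submodules by rewriting with an equality of sets. *)
Lemma submod_of_set A : A 0 -> (forall x y, A x -> A y -> A (x + y)) ->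
    (forall a x, A x -> A (a *: x)) ->
  exists N : submodClosed V, [set` N] = A.
Proof.
move=> A0 AD AZ; pose P : {pred V} := fun x => `[< A x >].
have PE x : (x \in P) = `[< A x >] by [].
have Pc : subsemimod_closed P.
  split; first split.
  - by rewrite PE; apply/asboolP.
  - by move=> x y /asboolP Ax /asboolP Ay; apply/asboolP/AD.
  - by move=> a x /asboolP Ax; apply/asboolP/AZ.
pose m := GRing.isSubmodClosed.Build R V P Pc.
pose N : submodClosed V := HB.pack P m.
by exists N; apply/seteqP; split=> x /asboolP.
Qed.

Lemma sumset_submod H1 H2 :
  exists N : submodClosed V, [set` N] = sumset [set` H1] [set` H2].
Proof.
apply: submod_of_set.
- by exists 0; [exact: rpred0 | exists 0; [exact: rpred0 | rewrite addr0]].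
- move=> _ _ [x Hx [y Hy <-]] [z Hz [t Ht <-]].
  exists (x + z); first exact: rpredD.
  by exists (y + t); [exact: rpredD | rewrite addrACA].
- move=> a _ [x Hx [y Hy <-]].
  exists (a *: x); first exact: rpredZ.
  by exists (a *: y); [exact: rpredZ | rewrite scalerDr].
Qed.

Lemma ann_in_module_submod (I : set R) :
  exists N : submodClosed V, [set` N] = ann_in_module V I.
Proof.
apply: submod_of_set.
- by move=> a _; rewrite scaler0.
- by move=> x y Ax Ay a Ia; rewrite scalerDr Ax // Ay // addr0.
- by move=> b x Ax a Ia; rewrite scalerA mulrC -scalerA Ax // scaler0.
Qed.

Lemma ann_in_module_sumset (I J : submodClosed R^o) :
  ann_in_module V (sumset [set` I] [set` J]) =
  ann_in_module V [set` I] `&` ann_in_module V [set` J].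
Proof.
apply/seteqP; split=> [m mA | m [mI mJ] _ [a Ia [b Jb <-]]].
  split=> a aA; apply: mA.
    by exists a => //; exists 0; [exact: rpred0 | rewrite addr0].
  by exists 0; [exact: rpred0 | exists a => //; rewrite add0r].
by rewrite scalerDl mI // mJ // addr0.
Qed.

Lemma sumset_subset A B A' B' : A `<=` A' -> B `<=` B' ->
  sumset A B `<=` sumset A' B'.
Proof.
by move=> sA sB _ [x Ax [y By <-]]; exists x; [exact: sA | exists y; [exact: sB|]].
Qed.

Lemma sub_sumset3 H1 H2 H3 :
  let S := sumset (sumset [set` H1] [set` H2]) [set` H3] in
  [/\ [set` H1] `<=` S, [set` H2] `<=` S & [set` H3] `<=` S].
Proof.
split=> x Hx.
- exists x; last by exists 0; [exact: rpred0 | rewrite addr0].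
  by exists x => //; exists 0; [exact: rpred0 | rewrite addr0].
- exists x; last by exists 0; [exact: rpred0 | rewrite addr0].
  by exists 0; [exact: rpred0 | exists x => //; rewrite add0r].
- exists 0; last by exists x => //; rewrite add0r.
  by exists 0; [exact: rpred0 | exists 0; [exact: rpred0 | rewrite addr0]].
Qed.

Lemma image_val_submod N (H : submodClosed (submod_type N)) :
  exists H' : submodClosed V, [set` H'] = val @` [set` H].
Proof.
apply: submod_of_set.
- by exists 0; [exact: rpred0 | rewrite raddf0].
- move=> _ _ [x Hx <-] [y Hy <-].
  by exists (x + y); [exact: rpredD | rewrite raddfD].
- by move=> a _ [x Hx <-]; exists (a *: x); [exact: rpredZ | rewrite linearZ].
Qed.

(** Submodules of the module [N] are pushed forward along [val] to submodules of [V]; injectivity of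
    [val] brings the resulting cover by two of them back. *)
Lemma sum2_irreducible_submod_module N :
  strongly_sum2_irreducible_submod N ->
  strongly_sum2_irreducible_module (submod_type N).
Proof.
move=> irrN H1 H2 H3 cov.
have [K1 E1] := image_val_submod H1.
have [K2 E2] := image_val_submod H2.
have [K3 E3] := image_val_submod H3.
have back (A B : set (submod_type N)) :
    [set` N] `<=` sumset (val @` A) (val @` B) ->
    [set` full_submod (V := submod_type N)] `<=` sumset A B.
  move=> s x _; have [_ [a Aa <-] [_ [b Bb <-] e]] := s _ (valP x).
  by exists a => //; exists b => //; apply: val_inj; rewrite raddfD.
have := irrN K1 K2 K3; rewrite E1 E2 E3; case.
- move=> x Nx.
  have [_ [a Ha [b Hb <-]] [c Hc e]] := cov (Sub x Nx) isT.
  exists (val a + val b).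
    by exists (val a); [exists a | exists (val b) => //; exists b].
  by exists (val c); [exists c | rewrite -!raddfD e].
- by move/back=> s; apply: Or31.
- by move/back=> s; apply: Or32.
- by move/back=> s; apply: Or33.
Qed.

End SubmoduleSets.

(** * Pulling submodules back to the module [N] *)

Section SubmoduleTypes.
Variables (R : comPzRingType) (V : lmodType R).
Implicit Types (A B : set V) (N H : submodClosed V).

Lemma preimage_val_submod N H :
  exists H' : submodClosed (submod_type N), [set` H'] = val @^-1` [set` H].
Proof.
apply: submod_of_set => [|x y Hx Hy|a x Hx].
- exact: rpred0.
- exact: rpredD.
- exact: rpredZ.
Qed.

(** The module [N] sees [Hi] only through its trace on [N]. The cover has to consist of traces,
    since summands of an element of [N] could otherwise lie outside [N]. *)
Lemma sum2_irreducible_module_cover N H1 H2 H3 :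
    strongly_sum2_irreducible_module (submod_type N) ->
    [set` N] `<=` sumset (sumset ([set` H1] `&` [set` N]) ([set` H2] `&` [set` N]))
                         ([set` H3] `&` [set` N]) ->
  [\/ [set` N] `<=` sumset [set` H1] [set` H2],
      [set` N] `<=` sumset [set` H2] [set` H3]
    | [set` N] `<=` sumset [set` H1] [set` H3]].
Proof.
move=> irrN cov.
have [K1 E1] := preimage_val_submod N H1.
have [K2 E2] := preimage_val_submod N H2.
have [K3 E3] := preimage_val_submod N H3.
have back A B :
    [set` full_submod (V := submod_type N)] `<=`
      sumset (val @^-1` A) (val @^-1` B) ->
    [set` N] `<=` sumset A B.
  move=> s x Nx; have [a Aa [b Bb e]] := s (Sub x Nx) isT.
  by exists (val a) => //; exists (val b) => //; rewrite -raddfD e.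
have := irrN K1 K2 K3; rewrite E1 E2 E3; case.
- move=> x _.
  have [_ [a [Ha Na] [b [Hb Nb] <-]] [c [Hc Nc] e]] := cov _ (valP x).
  pose u : submod_type N := Sub a Na.
  pose v : submod_type N := Sub b Nb.
  pose w : submod_type N := Sub c Nc.
  exists (u + v); last first.
    by exists w; [| apply: val_inj; rewrite !raddfD].
  by exists u; [| exists v].
- by move/back=> s; apply: Or31.
- by move/back=> s; apply: Or32.
- by move/back=> s; apply: Or33.
Qed.

End SubmoduleTypes.

Lemma ideals_sum2_irreducible_submod (R : comPzRingType) :
    (forall I : submodClosed R^o, nonzero_submod I -> proper_submod I ->
       strongly_sum2_irreducible_module (submod_type I)) ->
  forall I : submodClosed R^o, nonzero_submod I -> proper_submod I ->
    strongly_sum2_irreducible_submod I.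
Proof.
move=> irr I I0 IT J1 J2 J3 cov.
have [s1 s2 s3] := sub_sumset3 J1 J2 J3.
have [J12 E12] := sumset_submod J1 J2.
have [K EK] := sumset_submod J12 J3; rewrite E12 in EK.
rewrite -EK in cov s1 s2 s3.
have [KT|KT] := pselect ([set` K] = setT).
- apply: sum2_irreducible_module_cover; first exact: irr.
  (* Writing 1 = a + b + c with summands in the [Ji] gives x = xa + xb + xc for x in [I], and each
     term lies in both [Ji] and [I]. *)
  have : [set` K] 1 by rewrite KT.
  rewrite EK => -[_ [a Ja [b Jb <-]] [c Jc e1]] x Ix.
  have idl (J : submodClosed R^o) y : [set` J] y ->
      ([set` J] `&` [set` I]) (x * y).
    move=> Jy; split; first exact: (rpredZ x).
    by rewrite mulrC; exact: (rpredZ y).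
  exists (x * a + x * b).
    by exists (x * a); [exact: idl | exists (x * b); [exact: idl|]].
  by exists (x * c); [exact: idl | rewrite -!mulrDr e1 mulr1].
have K0 : nonzero_submod K.
  move=> K0; apply: I0; apply/seteqP; split; first by rewrite -K0.
  by move=> _ ->; exact: rpred0.
(* Each [Ji] is contained in [K], so its trace on [K] is [Ji] itself and the hypothesis applies to
   the module [K]. *)
have : [set` K] `<=` sumset (sumset ([set` J1] `&` [set` K])
    ([set` J2] `&` [set` K])) ([set` J3] `&` [set` K]).
  rewrite {1}EK; apply: sumset_subset; first apply: sumset_subset.
  - by move=> x Jx; split=> //; exact: s1.
  - by move=> x Jx; split=> //; exact: s2.
  - by move=> x Jx; split=> //; exact: s3.
case/(sum2_irreducible_module_cover (irr K K0 KT)) => s.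
- exact: Or31 (subset_trans cov s).
- exact: Or32 (subset_trans cov s).
- exact: Or33 (subset_trans cov s).
Qed.

(** * Duality between ideals of [R] and submodules of [M] *)

Section StrongComultiplication.
Variables (R : comPzRingType) (M : lmodType R).
Hypothesis hM : strong_comultiplication_module M.
Implicit Types (I J : submodClosed R^o) (N H : submodClosed M).

(** DAC gives the direction from left to right: an element of [I] kills (0 :_M J), hence lies in the
    double annihilator of [J], which is [J]. *)
Lemma ann_in_module_subset I J :
  (ann_in_module M [set` J] `<=` ann_in_module M [set` I]) =
  ([set` I] `<=` [set` J]).
Proof.
apply/propext; split=> [s | s m mJ a Ia]; last by apply: mJ; exact: s.
by rewrite (hM.2 J) => a Ia m /s; apply.
Qed.

Lemma ann_in_module_nonzero I N : [set` N] = ann_in_module M [set` I] ->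
  nonzero_submod N <-> proper_submod I.
Proof.
move=> EN; split=> nt E; apply: nt.
  apply/seteqP; split=> [m | _ ->]; last exact: rpred0.
  by rewrite EN E => /(_ 1 Logic.I); rewrite scale1r.
(* By DAC, [I] is the annihilator of [N]; if [N] is zero this is all of [R]. *)
rewrite (hM.2 I) -EN E; apply/seteqP; split=> // a _ _ ->.
exact: scaler0.
Qed.

Lemma ann_in_module_proper I N : [set` N] = ann_in_module M [set` I] ->
  proper_submod N <-> nonzero_submod I.
Proof.
move=> EN; split=> nt E; apply: nt.
  by rewrite EN E; apply/seteqP; split=> // m _ _ ->; rewrite scale0r.
(* The zero ideal has annihilator [M]; if [N] is also [M], order reflection puts [I] inside it. *)
have [Z EZ] : exists Z : submodClosed R^o, [set` Z] = [set 0].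
  apply: submod_of_set => [//|x y -> ->|a x ->]; first exact: addr0.
  exact: scaler0.
apply/seteqP; split; last by move=> _ ->; exact: rpred0.
rewrite -EZ -ann_in_module_subset -EN E EZ => m _.
by [].
Qed.

Lemma strongly_2_irreducible_ann I N : [set` N] = ann_in_module M [set` I] ->
  strongly_2_irreducible_submod N <->
  proper_submod N /\ strongly_sum2_irreducible_submod I.
Proof.
move=> EN.
have dual2 J1 J2 : (ann_in_module M [set` J1] `&` ann_in_module M [set` J2]
      `<=` [set` N]) = ([set` I] `<=` sumset [set` J1] [set` J2]).
  have [J E] := sumset_submod J1 J2.
  by rewrite -ann_in_module_sumset -E EN ann_in_module_subset.
have dual3 J1 J2 J3 : (ann_in_module M [set` J1] `&` ann_in_module M [set` J2]
      `&` ann_in_module M [set` J3] `<=` [set` N]) =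
    ([set` I] `<=` sumset (sumset [set` J1] [set` J2]) [set` J3]).
  have [J E] := sumset_submod J1 J2.
  by rewrite -ann_in_module_sumset -E dual2.
split=> -[NT irr]; split=> //.
  move=> J1 J2 J3; rewrite -dual3 -!dual2.
  have [H1 <-] := ann_in_module_submod M [set` J1].
  have [H2 <-] := ann_in_module_submod M [set` J2].
  have [H3 <-] := ann_in_module_submod M [set` J3].
  exact: irr.
move=> H1 H2 H3.
(* Comultiplication makes every [Hi] an annihilator, so testing against annihilators of ideals
   suffices. *)
have [J1 ->] := hM.1 H1.
have [J2 ->] := hM.1 H2.
have [J3 ->] := hM.1 H3.
rewrite dual3 !dual2; exact: irr.
Qed.

End StrongComultiplication.

Theorem theorem2p9 (R : comPzRingType) (M : lmodType R)
    (hM : strong_comultiplication_module M) :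
  (forall I : submodClosed R^o, nonzero_submod I -> proper_submod I ->
     strongly_sum2_irreducible_module (submod_type I)) <->
  (forall N : submodClosed M, nonzero_submod N -> proper_submod N ->
     strongly_2_irreducible_submod N).
Proof.
split=> [irr N N0 NT | irr I I0 IT].
  have [I EN] := hM.1 N.
  apply/(strongly_2_irreducible_ann hM EN); split=> //.
  apply: ideals_sum2_irreducible_submod => //.
    exact/(ann_in_module_proper hM EN).
  exact/(ann_in_module_nonzero hM EN).
(* The dual of [I] is non-zero because [I] is proper, and proper because [I] is non-zero. *)
have [N EN] := ann_in_module_submod M [set` I].
have N0 : nonzero_submod N by apply/(ann_in_module_nonzero hM EN).
have NT : proper_submod N by apply/(ann_in_module_proper hM EN).
apply: sum2_irreducible_submod_module.
by case/(strongly_2_irreducible_ann hM EN): (irr N N0 NT).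
Qed.
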